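(* There are no non-trivial repdigits which can be expressed as the difference of two Lucas-balancing numbers. That is, there are no integers $n > m \geq 0$, $k \geq 2$ and $d \in \{1,2,\ldots,9\}$ such that $$C_n - C_m = d\left(\frac{10^k-1}{9}\right),$$ where $(C_n)_{n\geq 0}$ is the Lucas-balancing sequence.
   Context: The Lucas-balancing sequence $(C_n)_{n\geq 0}$ is the integer sequence defined by $C_0 = 1$, $C_1 = 3$ and $C_{n+1} = 6C_n - C_{n-1}$ for $n \geq 1$. A repdigit is a positive integer with only one distinct digit when written in base 10, i.e. a number of the form $d\left(\frac{10^k-1}{9}\right)$ with $d \in \{1,2,\ldots,9\}$ and $k \geq 1$. It is called trivial if $k = 1$, and non-trivial if $k \geq 2$. *)

(* Defs.v *)
From Stdlib Require Export ZArith.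

Open Scope Z_scope.

Fixpoint lucas_balancing (n : nat) : Z :=
  match n with
  | O => 1
  | S m => match m with
           | O => 3
           | S p => 6 * lucas_balancing m - lucas_balancing p
           end
  end.

(* [/] is floor division on Z; it is exact for repunits (see [repunit_exact]). *)
Definition repdigit (d k : Z) : Z := d * ((10 ^ k - 1) / 9).

Lemma repunit_exact (k : Z) : 0 <= k -> 9 * ((10 ^ k - 1) / 9) = 10 ^ k - 1.
Proof.
intros Hk; symmetry; apply Z.div_exact; [discriminate|].
pattern k; apply natlike_ind; [reflexivity| |exact Hk].
intros x Hx IH; rewrite Z.pow_succ_r by exact Hx.
replace (10 * 10 ^ x - 1) with (10 ^ x - 1 + 10 ^ x * 9) by ring.
rewrite Z.mod_add by discriminate; exact IH.
Qed.

(* Main.v *)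
(** The Lucas-balancing sequence has period 12 modulo 1680 = 16 * 3 * 5 * 7,
    and repdigits with a fixed digit and at least 4 digits have period 6 in the
    number of digits, since [10 ^ 4 * 111111] is divisible by 1680. So only
    finitely many residues have to be compared, and they never agree. *)

From Stdlib Require Import List Lia.
Require Import Defs.

Lemma lucas_balancing_period (n : nat) :
  lucas_balancing (12 + n) mod 1680 = lucas_balancing n mod 1680.
Proof.
assert (SS : forall p, lucas_balancing (S (S p)) =
                       6 * lucas_balancing (S p) - lucas_balancing p) by reflexivity.
(* The recurrence has order two, so the induction carries two consecutive congruences. *)
enough (H : lucas_balancing (12 + n) mod 1680 = lucas_balancing n mod 1680 /\
            lucas_balancing (12 + S n) mod 1680 = lucas_balancing (S n) mod 1680)
  by apply H.
induction n as [|n [IH IHS]]; [split; reflexivity|].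
split; [exact IHS|].
replace (12 + S (S n))%nat with (S (S (12 + n))) by reflexivity.
rewrite !SS; change (S (12 + n)) with (12 + S n)%nat.
rewrite Zminus_mod, Zmult_mod, IH, IHS, <- Zmult_mod, <- Zminus_mod; reflexivity.
Qed.

Lemma lucas_balancing_mod (n : nat) :
  exists i : nat, In i (seq 0 12) /\
    lucas_balancing n mod 1680 = lucas_balancing i mod 1680.
Proof.
induction n as [n IH] using (well_founded_induction lt_wf).
destruct (Nat.lt_ge_cases n 12) as [Hn|Hn].
- exists n; split; [apply in_seq; lia|reflexivity].
- destruct (IH (n - 12)%nat) as [i [Hi Ei]]; [lia|].
  exists i; split; [exact Hi|].
  rewrite <- Ei, <- (lucas_balancing_period (n - 12)); do 2 f_equal; lia.
Qed.

Lemma repdigit_period (d k : Z) :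
  4 <= k -> repdigit d (k + 6) mod 1680 = repdigit d k mod 1680.
Proof.
intros Hk.
assert (E : 10 ^ k = 10 ^ (k - 4) * 10000).
{ change 10000 with (10 ^ 4); rewrite <- Z.pow_add_r by lia; f_equal; lia. }
assert (E6 : 10 ^ (k + 6) = 10 ^ k * 1000000) by (apply Z.pow_add_r; lia).
pose proof (repunit_exact k ltac:(lia)) as R.
pose proof (repunit_exact (k + 6) ltac:(lia)) as R6.
unfold repdigit.
(* The two repunits differ by [10 ^ k * 111111], and [661375 * 1680 = 10 ^ 4 * 111111]; exactness of
   both divisions by 9 makes this linear in [10 ^ (k - 4)]. *)
replace ((10 ^ (k + 6) - 1) / 9)
  with ((10 ^ k - 1) / 9 + 10 ^ (k - 4) * 661375 * 1680) by lia.
rewrite Z.mul_add_distr_l, !Z.mul_assoc; apply Z.mod_add; discriminate.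
Qed.

(** The lengths 2 and 3 precede the periodic range, and 4 to 9 form one full period. Descent by 6
    starts only from [k >= 10], so it never leaves the range [4 <= k]. *)
Lemma repdigit_mod (d k : Z) :
  2 <= k -> exists j : nat, In j (seq 2 8) /\
    repdigit d k mod 1680 = repdigit d (Z.of_nat j) mod 1680.
Proof.
intros Hk; assert (H0 : 0 <= k) by lia; revert Hk.
pattern k; apply Zlt_0_ind; [clear k H0; intros k IH _ Hk|exact H0].
destruct (Z.lt_ge_cases k 10) as [H|H].
- exists (Z.to_nat k); split; [apply in_seq; lia|].
  rewrite Z2Nat.id by lia; reflexivity.
- destruct (IH (k - 6)) as [j [Hj Ej]]; [lia|lia|].
  exists j; split; [exact Hj|].
  rewrite <- Ej, <- (repdigit_period d (k - 6)) by lia; do 2 f_equal; lia.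
Qed.

(** The indices [i] and [j] range independently, as reduction modulo 12 forgets the order of [n] and
    [m]. Lengths start at 2 because $C_1 - C_0 = 2$ is a trivial repdigit. *)
Lemma residues_disjoint :
  forallb (fun i => forallb (fun j => forallb (fun k => forallb (fun d =>
    negb ((lucas_balancing i mod 1680 - lucas_balancing j mod 1680) mod 1680
          =? repdigit (Z.of_nat d) (Z.of_nat k) mod 1680))
    (seq 1 9)) (seq 2 8)) (seq 0 12)) (seq 0 12) = true.
Proof. vm_compute; reflexivity. Qed.

Theorem theorem4p1 :
  ~ exists (n m : nat) (k d : Z),
      (n > m)%nat /\ k >= 2 /\ 1 <= d <= 9 /\ lucas_balancing n - lucas_balancing m = repdigit d k.
Proof.
intros (n & m & k & d & _ & Hk & Hd & E).
destruct (lucas_balancing_mod n) as [i [Hi Ei]].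
destruct (lucas_balancing_mod m) as [j [Hj Ej]].
destruct (repdigit_mod d k) as [l [Hl El]]; [lia|].
pose proof residues_disjoint as D.
rewrite forallb_forall in D; specialize (D i Hi).
rewrite forallb_forall in D; specialize (D j Hj).
rewrite forallb_forall in D; specialize (D l Hl).
rewrite forallb_forall in D; specialize (D (Z.to_nat d)).
(* Both sides of the test become [repdigit d k mod 1680], so the conclusion of [D] is absurd; its
   premise, that [d] lies in 1 to 9, is what remains to prove. *)
rewrite Z2Nat.id, <- El, <- E, <- Ei, <- Ej, <- Zminus_mod, Z.eqb_refl in D by lia.
discriminate D; apply in_seq; lia.
Qed.
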